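(* Let $G$ be a finite group of order $n$. Then: (a) $\sigma_1(G)<2+\frac{4}{n}$ if and only if either ($G$ is cyclic and $\sigma(n)<2n+4$) or $G\cong\mathbb{Z}_2\times\mathbb{Z}_2$; (b) $\sigma_1(G)=2+\frac{4}{n}$ if and only if either ($G$ is cyclic and $\sigma(n)=2n+4$) or $G\cong\mathbb{Z}_3\times\mathbb{Z}_3$ or $G\cong S_3$.
   Context: For a finite group $G$, let $L(G)$ denote the set (lattice) of all subgroups of $G$, including the trivial subgroup and $G$ itself, and define $\sigma_1(G)=\sum_{H\in L(G)}\frac{|H|}{|G|}=\sum_{H\in L(G)}\frac{1}{|G:H|}$. For a positive integer $n$, $\sigma(n)$ denotes the sum of all positive divisors of $n$. $\mathbb{Z}_m$ is the cyclic group of order $m$, and $S_3$ is the symmetric group on three letters. *)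

(* Defs.v *)
From mathcomp Require Import all_boot all_order all_algebra all_fingroup all_solvable.

Set Implicit Arguments.
Unset Strict Implicit.
Unset Printing Implicit Defensive.

Import GRing.Theory Num.Theory.
Local Open Scope ring_scope.

Definition sigma1 (gT : finGroupType) (G : {group gT}) : rat :=
  \sum_(H in subgroups G) #|H|%:R / #|G|%:R.

(* Only meaningful for n > 0: the library sets divisors 0 = [:: 1]. *)
Definition sum_divisors (n : nat) : nat := (\sum_(d <- divisors n) d)%N.

(* Main.v *)
Require Import Defs.
From mathcomp Require Import all_boot all_order all_algebra all_fingroup all_solvable.
From mathcomp Require Import zify.

(** Multiply by n: the two sides of the comparison become the sum s of the
    orders of all subgroups of G, and 2n + 4.  For G cyclic, s = sigma(n), so
    everything is about noncyclic G.

    Each element generates one cyclic subgroup, and a cyclic group C has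
    phi(|C|) generators, so the numbers phi(|C|), for C cyclic in G, add up to
    n ([sum_totient_cyclic]).  When G is not cyclic all these C are proper, so
    splitting off phi(|C|) from each |C| yields a second copy of n beside the
    term |G| = n: s = 2n + E, where E collects over the proper subgroups H the
    number [totient_defect H], that is |H| - phi(|H|) if H is cyclic and |H|
    if it is not ([sum_card_noncyclic]).  Every nontrivial proper subgroup
    contributes at least 1 to E, and the question is when E <= 4.

    Suppose E <= 4.  Then a cyclic subgroup of largest order has prime order p
    ([small_defect_prime_order]), and there are at most 4 nontrivial cyclic
    subgroups, each with at most p - 1 generators, so n <= 1 + 4(p - 1) < 4p
    and n is 2p or 3p.  If p exceeds the cofactor m = n / p there is only one
    subgroup of order p, all other nontrivial cyclic subgroups have order m,
    and the same count of generators bounds p by 3.  Hence n is 4, 6 or 9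
    ([order_small_defect]).

    Conversely a noncyclic group of order qp, with q <= p primes, has p + 1
    nontrivial proper subgroups, all of prime order, so E = p + 1
    ([defect_pq]): E is 3 for n = 4, and 4 for n = 6 and n = 9.  The noncyclic
    groups of order 4, 6 and 9 are Z_2 x Z_2, S_3 and Z_3 x Z_3
    ([isog_Zp_square], [isog_S3]). *)

Section SubgroupOrders.
Local Set Implicit Arguments.
Local Unset Strict Implicit.
Local Open Scope group_scope.
Local Open Scope nat_scope.
Context {gT : finGroupType}.
Implicit Types (G H P Q C : {group gT}) (x : gT).

(** * Sums over the subgroups of a group *)

(** Sort the elements of G by the cyclic subgroup that they generate. *)
Lemma sum_totient_cyclic G :
  \sum_(C : {group gT} | (C \subset G) && cyclic C) totient #|C| = #|G|.
Proof.
rewrite -[RHS]sum1_card.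
rewrite (partition_big (fun x => <[x]>%G)
          (fun C : {group gT} => (C \subset G) && cyclic C)); last first.
  by move=> x Gx; rewrite /= cycle_subG Gx cycle_cyclic.
apply: eq_bigr => C /andP[sCG /cyclicP[x defC]].
rewrite sum1dep_card defC totient_gen; apply: eq_card => y.
rewrite !inE /generator -defC; apply/eqP/andP=> [eqC | [_ /eqP <-] //].
by split; [rewrite -cycle_subG -eqC | apply/eqP/val_inj].
Qed.

Definition totient_defect H := #|H| - (if cyclic H then totient #|H| else 0).

Lemma totient_defect_gt0 H : H :!=: 1%g -> 0 < totient_defect H.
Proof.
move=> ntH; rewrite /totient_defect; case: ifP => [cycH | _]; last first.
  by rewrite subn0 cardG_gt0.
rewrite subn_gt0 -[ltnRHS](sum_totient_cyclic H) (bigD1 H) ?subxx //=.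
rewrite (bigD1 1%G) ?sub1G ?cyclic1 //= ?cards1.
  by rewrite (_ : totient 1 = 1) //; lia.
by rewrite -(inj_eq val_inj) /= eq_sym.
Qed.

(** Apply [sum_totient_cyclic] to H: the terms of H, of C and of the trivial
    group already show totient #|H| + totient #|C| + 1 <= #|H|. *)
Lemma totient_defect_gt1 H C :
  C :!=: 1%g -> C \proper H -> cyclic H -> 1 < totient_defect H.
Proof.
move=> ntC; rewrite properEneq => /andP[neCH sCH] cycH.
have cycC := cyclicS sCH cycH.
rewrite /totient_defect cycH ltn_subRL -[ltnRHS](sum_totient_cyclic H).
rewrite (bigD1 H) ?subxx //= (bigD1 C) ?sCH ?cycC //=.
rewrite (bigD1 1%G) /= ?sub1G ?cyclic1 ?cards1 ?totient_gt0 //=.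
  rewrite (_ : totient 1 = 1) // ltn_add2l addnA ltn_addr //.
  by rewrite -[ltnLHS]add0n ltn_add2r totient_gt0 cardG_gt0.
apply/andP; split; last by apply: contraNneq ntC => <-.
by apply: contraNneq ntC => H1; move: sCH; rewrite -H1 subG1.
Qed.

(** The proper cyclic subgroups are all the cyclic ones here, so their totients
    supply the second #|G|. *)
Lemma sum_card_noncyclic G : ~~ cyclic G ->
  \sum_(H in subgroups G) #|H|
    = 2 * #|G| + \sum_(H : {group gT} | H \proper G) totient_defect H.
Proof.
move=> ncycG; rewrite (bigD1 G) ?inE //= mul2n -addnn -addnA; congr (_ + _).
have eqP H : (H \in subgroups G) && (H != G) = (H \proper G).
  by rewrite inE properEneq andbC.
rewrite (eq_bigl _ _ eqP).
have <- : \sum_(H : {group gT} | (H \proper G) && cyclic H) totient #|H| = #|G|.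
  rewrite -[RHS](sum_totient_cyclic G); apply: eq_bigl => H.
  rewrite properEneq; case: eqVneq => //= /val_inj->.
  by rewrite subxx (negPf ncycG).
rewrite [X in _ = X + _]big_mkcondr -big_split /=; apply: eq_bigr => H _.
rewrite /totient_defect subnKC //.
case: ifP => // cycH; rewrite -[leqRHS](sum_totient_cyclic H).
by rewrite (bigD1 H) ?subxx //= leq_addr.
Qed.

(** A cyclic group has exactly one subgroup of each order dividing its own. *)
Lemma sum_card_cyclic G : cyclic G ->
  \sum_(H in subgroups G) #|H| = sum_divisors #|G|.
Proof.
move=> cycG; rewrite /sum_divisors -big_enum.
rewrite -(big_map (fun H : {group gT} => #|H|) xpredT id).
apply: perm_big; apply: uniq_perm; rewrite ?divisors_uniq //.
  rewrite map_inj_in_uniq ?enum_uniq // => H K; rewrite !mem_enum !inE => sHG sKG eqHK.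
  by apply/val_inj/eqP; rewrite /= (eq_subG_cyclic cycG) ?eqHK.
move=> d; rewrite -dvdn_divisors ?cardG_gt0 //; apply/mapP/idP=> [[H + ->] | dvdG].
  by rewrite mem_enum inE; apply: cardSg.
have [x defG] := cyclicP cycG.
have dvdx : d %| #[x] by rewrite orderE -defG.
exists <[(x ^+ (#[x] %/ d))%g]>%G.
  by rewrite mem_enum inE defG /= cycleX.
have := cycle_sub_group dvdx; move/setP/(_ <[(x ^+ (#[x] %/ d))%g]>%G).
by rewrite !inE eqxx => /andP[_ /eqP].
Qed.

(** * Noncyclic groups of small total defect *)

(** Let x have maximal order, suppose that this order is not prime, and take y
    outside <[x]>.  Then y and y * x generate two cyclic subgroups different
    from each other and from <[x]>: a common one would contain x, hence be
    <[x]> by maximality.  With a subgroup <[c]> of prime order in <[x]>, this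
    makes three subgroups of defect at least 1 besides <[x]>, whose defect is
    at least 2 because of <[c]>, so the total is at least 5. *)
Lemma small_defect_prime_order G :
    ~~ cyclic G -> \sum_(H : {group gT} | H \proper G) totient_defect H <= 4 ->
  exists x, [/\ x \in G, prime #[x] & forall y, y \in G -> #[y] <= #[x]].
Proof.
move=> ncycG; case: (@arg_maxnP _ 1%g (mem G) order) => [|x]; first exact: group1.
rewrite /= => Gx max_x; rewrite leqNgt => /negP defect_le4.
exists x; split=> //.
have [x1|ntx] := eqVneq x 1%g.
  case/negP: ncycG; rewrite (_ : G = 1%G) ?cyclic1 //; apply/val_inj/trivgP.
  apply/subsetP=> y /max_x; rewrite x1 order1 inE -order_eq1.
  by have := order_gt0 y; rewrite /order; lia.
apply: wlog_neg => nprx; case: defect_le4.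
have sub_proper y : y \in G -> <[y]> \proper G.
  move=> Gy; rewrite properEneq cycle_subG Gy andbT.
  by apply: contraNneq ncycG => <-; apply: cycle_cyclic.
have [y Gy nxy] : exists2 y, y \in G & y \notin <[x]>.
  by have /properP[_] := sub_proper x Gx.
have nxyx : (y * x)%g \notin <[x]> by rewrite groupMr ?cycle_id.
have absorb z : z \in G -> x \in <[z]> -> <[z]> = <[x]>.
  move=> Gz xz; apply/eqP; rewrite eq_sym eqEcard cycle_subG xz.
  exact: max_x.
have pr_q : prime (pdiv #[x]) by rewrite pdiv_prime // order_gt1.
have [c cx oc] := Cauchy pr_q (pdiv_dvd #[x]).
have ntc : <[c]> != 1%g by rewrite cycle_eq1 -order_gt1 oc prime_gt1.
have necx : <[c]> != <[x]>.
  by apply: contraNneq nprx => ecx; rewrite orderE -ecx -orderE oc.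
have pcx : <[c]> \proper <[x]> by rewrite properEneq necx cycle_subG.
rewrite (bigD1 <[x]>%G) ?sub_proper //=.
have := totient_defect_gt1 ntc pcx (cycle_cyclic x).
set R := \sum_(H | _) _; suff: 3 <= R by lia.
pose s := [:: <[c]>%G; <[y]>%G; <[(y * x)%g]>%G].
have nt z : z \notin <[x]> -> <[z]> != 1%g.
  by rewrite cycle_eq1; apply: contraNneq => ->.
have nsub z : z \notin <[x]> -> <[z]>%G != <[x]>%G.
  by apply: contraNneq => /(congr1 val)/= <-; apply: cycle_id.
have nsubc z : z \notin <[x]> -> <[c]>%G != <[z]>%G.
  apply: contraNneq => /(congr1 val)/= cz; apply: (subsetP (proper_sub pcx)).
  by rewrite cz cycle_id.
have us : uniq s.
  rewrite /= !inE negb_or !nsubc //= andbT.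
  apply: contraNneq nxy => /(congr1 val)/= eqyx; rewrite -cycle_subG (absorb y) //.
  by rewrite -(groupMl _ (cycle_id y)) /= eqyx cycle_id.
have Gc : c \in G by apply: subsetP cx; rewrite cycle_subG.
rewrite -[3]/(size s) -(card_uniqP us) -sum1_card /R big_mkcond /=.
rewrite [leqRHS]big_mkcond; apply: leq_sum => H _; case: ifP => //.
have counted z : z \in G -> <[z]> != 1%g -> <[z]>%G != <[x]>%G ->
    0 < (if (<[z]> \proper G) && (<[z]>%G != <[x]>%G)
         then totient_defect <[z]>%G else 0).
  by move=> Gz ntz nezx; rewrite sub_proper // nezx totient_defect_gt0.
rewrite !inE => /or3P[] /eqP->; apply: counted; rewrite ?groupM //.
- exact: nt.
- exact: nsub.
- exact: nt.
exact: nsub.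
Qed.

(** Otherwise P and Q meet trivially and P * Q has #|P| ^ 2 elements. *)
Lemma lone_large_prime_subgroup G P Q :
    P \subset G -> Q \subset G -> prime #|P| -> #|Q| = #|P| ->
  #|G| < #|P| ^ 2 -> Q = P.
Proof.
move=> sPG sQG prP oQ; apply: contraTeq => neQP; rewrite -leqNgt.
suff tiPQ : P :&: Q = 1%g.
  by rewrite expnS expn1 -{2}oQ -(TI_cardMg tiPQ) subset_leq_card ?mul_subG.
apply: prime_TIg => //; apply: contraNN neQP => sPQ.
by apply/eqP/esym/val_inj/eqP; rewrite /= eqEcard sPQ oQ /=.
Qed.

(** Both bounds on #|G| come from counting the generators of its at most four
    nontrivial cyclic subgroups. *)
Lemma order_small_defect G :
    ~~ cyclic G -> \sum_(H : {group gT} | H \proper G) totient_defect H <= 4 ->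
  #|G| \in [:: 4; 6; 9].
Proof.
move=> ncycG defect_le4.
have [x [Gx pr_p max_p]] := small_defect_prime_order ncycG defect_le4.
pose P := <[x]>%G; set p := #[x] in pr_p max_p.
have p_gt1 := prime_gt1 pr_p.
have sPG : P \subset G by rewrite cycle_subG.
pose nt := [set C : {group gT} | [&& C \subset G, cyclic C & C != 1%G]].
have nt_le4 : #|nt| <= 4.
  apply: leq_trans defect_le4; rewrite -sum1_card big_mkcond [leqRHS]big_mkcond.
  apply: leq_sum => C _; rewrite inE; case: ifP => // /and3P[sCG cycC ntC].
  rewrite properEneq sCG andbT ifT.
    by rewrite totient_defect_gt0 //; apply: contraNneq ntC => /val_inj->.
  by apply: contraNneq ncycG => <-.
have oG : #|G| = 1 + \sum_(C in nt) totient #|C|.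
  rewrite -[LHS](sum_totient_cyclic G) (bigD1 1%G) ?sub1G ?cyclic1 //= cards1.
  by congr (_ + _); apply: eq_bigl => C; rewrite inE andbA.
have ord_le C : C \in nt -> 1 < #|C| <= p.
  rewrite inE => /and3P[sCG /cyclicP[y defC] ntC]; rewrite defC -orderE max_p.
    rewrite order_gt1 andbT; apply: contraNneq ntC => y1.
    by apply/eqP/val_inj; rewrite /= defC y1 cycle1.
  by rewrite -cycle_subG -defC.
have phi_le C d : C \in nt -> #|C| <= d -> totient #|C| <= d.-1.
  move=> ntC leCd; have/andP[C1 _] := ord_le C ntC.
  apply: leq_trans (_ : #|C|.-1 <= _); last by rewrite -!subn1 leq_sub2r.
  have := totient_defect_gt0 (H := C); rewrite /totient_defect.
  move: ntC; rewrite inE => /and3P[_ -> ntC]; rewrite subn_gt0 => lt_phi.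
  by rewrite -ltnS prednK ?lt_phi 1?ltnW //; apply: contraNneq ntC => /val_inj->.
have [m oGm] : exists m, #|G| = m * p.
  by exists (#|G| %/ p); rewrite divnK // order_dvdG.
have m_gt1 : 1 < m.
  case: m oGm => [|[|m]] // oG'; first by have := cardG_gt0 G; rewrite oG'.
  case/negP: ncycG; have <- : P = G; last exact: cycle_cyclic.
  by apply/val_inj/eqP; rewrite /= eqEcard oG' mul1n leqnn andbT.
(* m * p <= 1 + 4 * (p - 1) < 4 * p *)
have m_lt4 : m < 4.
  have: \sum_(C in nt) totient #|C| <= #|nt| * p.-1.
    rewrite -sum_nat_const; apply: leq_sum => C ntC; apply: phi_le => //.
    by case/andP: (ord_le C ntC).
  nia.
have [le_pm | lt_mp] := leqP p m.
  rewrite oGm !inE.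
  have [|] : p = 2 \/ p = 3 by lia.
    by move=> p2; rewrite p2; lia.
  by move=> p3; rewrite p3; lia.
have P_nt : P \in nt.
  by rewrite inE sPG cycle_cyclic -(inj_eq val_inj) /= cycle_eq1 -order_gt1.
have oP : #|P| = p by [].
(* Here P is the only subgroup of order p, and the order of any other cyclic
   subgroup is prime to p, hence divides m. *)
have others C : C \in nt -> C != P -> totient #|C| <= m.-1.
  move=> ntC; apply: contraNT; rewrite -ltnNge => gt_phi.
  have sCG : C \subset G by move: ntC; rewrite inE => /and3P[].
  have/andP[C1 Cp] := ord_le C ntC.
  apply/eqP; apply: (lone_large_prime_subgroup sPG) => //.
    apply/eqP; rewrite eqn_leq Cp leqNgt; apply/negP => ltCp.
    have: #|C| %| m.
      have : #|C| %| m * p by rewrite -oGm cardSg.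
      by rewrite Gauss_dvdl // coprime_sym prime_coprime // gtnNdvd // ltnW.
    by move/dvdn_leq => /(_ (ltnW m_gt1)) /(phi_le _ _ ntC); rewrite leqNgt gt_phi.
  by rewrite oP oGm expnS expn1 ltn_pmul2r // ltnW.
have: \sum_(C in nt | C != P) totient #|C| <= (#|nt| - 1) * m.-1.
  have -> : #|nt| - 1 = #|nt :\ P| by rewrite (cardsD1 P nt) P_nt addnC addnK.
  rewrite -sum_nat_const [leqRHS](eq_bigl (fun C => (C \in nt) && (C != P))).
    by apply: leq_sum => C /andP[]; apply: others.
  by move=> C; rewrite !inE andbC.
(* m * p <= 1 + (p - 1) + 3 * (m - 1), so p <= 3 *)
move: oG; rewrite (bigD1 P) //= oP totient_prime // oGm !inE.
move: nt_le4 (\sum_(C in nt | _) _) => + s; move: #|nt| => k.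
have [->|->] : m = 2 \/ m = 3 by lia.
  by lia.
by lia.
Qed.

(** Nontrivial proper subgroups have prime order, so their defect is 1 and the
    sum is their number k, which the count of generators determines: if q = p then
    p * p = 1 + k * (p - 1); if q < p only one of them has order p and
    q * p = 1 + (p - 1) + (k - 1) * (q - 1).  Both give k = p + 1. *)
Lemma defect_pq G p q :
    ~~ cyclic G -> prime p -> prime q -> q <= p -> #|G| = q * p ->
  \sum_(H : {group gT} | H \proper G) totient_defect H = p.+1.
Proof.
move=> ncycG pr_p pr_q le_qp oG.
have p_gt1 := prime_gt1 pr_p; have q_gt1 := prime_gt1 pr_q.
pose pr := [set H : {group gT} | (H \proper G) && (H != 1%G)].
have ord H : H \in pr -> (#|H| == p) || (#|H| == q).
  rewrite inE => /andP[/andP[sHG nsGH] ntH]; have := cardSg sHG; rewrite oG.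
  have oH1 : #|H| != 1 by apply: contraNneq ntH => /card1_trivg/val_inj->.
  have oHG : #|H| != q * p.
    apply: contraNneq nsGH => oH; have/eqP-> // : H == G :> {set gT}.
    by rewrite eqEcard sHG oG oH leqnn.
  have [/dvdnP[e oH] | ndvd] := boolP (p %| #|H|).
    move: oHG; rewrite oH dvdn_pmul2r ?(ltnW p_gt1) // => neH.
    case/(proj2 (primeP pr_q))/pred2P=> de; first by rewrite de mul1n eqxx.
    by rewrite de eqxx in neH.
  rewrite Gauss_dvdl 1?coprime_sym ?prime_coprime //.
  by case/(proj2 (primeP pr_q))/pred2P=> dH; rewrite dH eqxx ?orbT // in oH1 *.
have cyc H : H \in pr -> prime #|H| by case/ord/orP=> /eqP->.
have -> : \sum_(H : {group gT} | H \proper G) totient_defect H = #|pr|.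
  rewrite (bigD1 1%G) /=; last first.
    by rewrite properEneq sub1G andbT; apply: contraNneq ncycG => <-; apply: cyclic1.
  rewrite -sum1_card /totient_defect cyclic1 cards1 (_ : totient 1 = 1) //.
  rewrite subnn add0n [RHS](eq_bigl (fun H => (H \proper G) && (H != 1%G))).
    apply: eq_bigr => H prH; have prime_H : prime #|H| by apply: cyc; rewrite inE.
    rewrite prime_cyclic // totient_prime //; have := prime_gt1 prime_H; lia.
  by move=> H; rewrite inE.
have oG1 : #|G| = 1 + \sum_(H in pr) #|H|.-1.
  rewrite -[LHS](sum_totient_cyclic G) (bigD1 1%G) ?sub1G ?cyclic1 //= cards1.
  congr (_ + _); rewrite [RHS](eq_bigr (fun H : {group gT} => totient #|H|)).
    apply: eq_bigl => H; rewrite inE properEneq.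
    case: (eqVneq H 1%G) => [-> | ntH]; rewrite ?andbF // !andbT.
    case: (eqVneq (H : {set gT}) G) => [-> | neHG] /=.
      by rewrite (negPf ncycG) andbF.
    case sHG: (H \subset G) => //=; apply: prime_cyclic; apply: cyc.
    by rewrite inE properEneq neHG sHG.
  by move=> H /cyc/totient_prime.
have [eq_qp | ne_qp] := eqVneq q p.
  move: oG1; rewrite (eq_bigr (fun=> p.-1)) ?sum_nat_const.
    by rewrite oG eq_qp; move: #|pr| => k; nia.
  by move=> H /ord; rewrite eq_qp orbb => /eqP->.
have lt_qp : q < p by rewrite ltn_neqAle ne_qp.
have [x Gx ox] : {x | x \in G & #[x] = p}.
  by apply: Cauchy => //; rewrite oG dvdn_mull.
pose P := <[x]>%G.
have prP : P \in pr.
  rewrite inE properEneq cycle_subG Gx andbT; apply/andP; split.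
    by apply: contraNneq ncycG => <-; apply: cycle_cyclic.
  by apply/eqP=> /(congr1 val)/= /eqP; rewrite cycle_eq1 -order_eq1 ox; lia.
move: oG1; rewrite (bigD1 P) //= -orderE ox.
rewrite (eq_bigr (fun=> q.-1)) => [|H /andP[prH neHP]].
  rewrite (eq_bigl (mem (pr :\ P))); last by move=> H; rewrite !inE andbC.
  rewrite sum_nat_const oG (cardsD1 P pr) prP; move: #|pr :\ P| => k; nia.
case/orP: (ord H prH) => /eqP oH; last by rewrite oH.
case/eqP: neHP; have sub K : K \in pr -> K \subset G.
  by rewrite inE => /andP[/proper_sub].
apply: (lone_large_prime_subgroup (sub P prP) (sub H prH)).
- by rewrite -orderE ox.
- by rewrite -orderE ox.
by rewrite -orderE ox oG expnS expn1 ltn_pmul2r // ltnW.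
Qed.

(** * Noncyclic groups of order 4, 6 and 9 *)

Lemma noncyclic_p2_abelem p G :
  prime p -> ~~ cyclic G -> #|G| = p ^ 2 -> p.-abelem G.
Proof.
move=> pr_p ncycG oG; rewrite abelemE // (card_p2group_abelian pr_p oG) /=.
apply/exponentP=> x Gx; apply/eqP; rewrite -order_dvdn.
have: #[x] %| p ^ 2 by rewrite -oG order_dvdG.
case/(dvdn_pfactor _ _ pr_p) => -[|[|[|//]]] // _ ox; rewrite ox ?dvd1n //.
case/negP: ncycG; have <- : <[x]>%G = G; last exact: cycle_cyclic.
by apply/val_inj/eqP; rewrite /= eqEcard cycle_subG Gx -orderE ox oG leqnn.
Qed.

(** Take a of order 2 and b of order 3.  They do not commute, for a * b would
    have order 6, so a and a ^ b are distinct involutions.  These generate a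
    dihedral group, whose order is even, greater than 2 and a divisor of 6. *)
Lemma noncyclic6_dihedral G : ~~ cyclic G -> #|G| = 6 -> G \isog [set: 'D_6].
Proof.
move=> ncycG oG.
have [a Ga oa] : {a | a \in G & #[a] = 2} by apply: Cauchy; rewrite ?oG.
have [b Gb ob] : {b | b \in G & #[b] = 3} by apply: Cauchy; rewrite ?oG.
have neaab : a != (a ^ b)%g.
  apply: contraNneq ncycG => /esym/conjg_fixP/commgP cab.
  have oab : #[(a * b)%g] = 6 by rewrite orderM ?oa ?ob.
  have <- : <[(a * b)%g]>%G = G; last exact: cycle_cyclic.
  by apply/val_inj/eqP; rewrite /= eqEcard cycle_subG groupM //= -orderE oab oG.
have := involutions_gen_dihedral oa _ neaab; rewrite orderJ => /(_ oa).
pose D := <<[set a; (a ^ b)%g]>>%G.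
suff -> : <<[set a; (a ^ b)%g]>> = G by rewrite oG.
rewrite -[<<_>>]/(gval D).
have sDG : D \subset G by rewrite gen_subG subUset !sub1set groupJ ?Ga.
have Da : a \in D by rewrite mem_gen ?set21.
have Dab : (a ^ b)%g \in D by rewrite mem_gen ?set22.
apply/eqP; rewrite eqEcard sDG oG /=.
have dvD6 : #|D| %| 6 by rewrite -oG cardSg.
have dv2D : 2 %| #|D| by rewrite -oa order_dvdG.
(* 1, a and a ^ b are three elements of D *)
have D_gt2 : 2 < #|D|.
  have ntaa : a != 1%g by rewrite -order_eq1 oa.
  have us : uniq [:: 1%g; a; (a ^ b)%g].
    by rewrite /= !inE negb_or ![1%g == _]eq_sym conjg_eq1 ntaa neaab.
  rewrite -[3]/(size [:: 1%g; a; (a ^ b)%g]) -(card_uniqP us).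
  by apply/subset_leq_card/subsetP=> z; rewrite !inE => /or3P[]/eqP->.
by case/dvdnP: dv2D => k oD; move: dvD6 D_gt2; rewrite oD; case: k {oD} => [|[|[|]]].
Qed.

End SubgroupOrders.

Section IsomorphismTypes.
Local Open Scope group_scope.
Local Open Scope nat_scope.
Local Set Implicit Arguments.
Local Unset Strict Implicit.
Context {gT : finGroupType}.
Implicit Types (G : {group gT}).

Lemma isog_S3 G : (G \isog [set: 'S_3]) = ~~ cyclic G && (#|G| == 6).
Proof.
have ncycS : ~~ cyclic [set: 'S_3].
  apply/negP=> /cyclic_abelian/centsP/(_ _ (in_setT _) _ (in_setT _)) cS.
  pose i0 : 'I_3 := inord 0; pose i1 : 'I_3 := inord 1; pose i2 : 'I_3 := inord 2.
  (* the two products send i0 to i2 and to i1 *)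
  have /permP/(_ i0) := cS (tperm i0 i1) (tperm i1 i2).
  rewrite !permM tpermL tpermL (tpermD (y := i2)) ?tpermL;
    by rewrite -?val_eqE /= ?inordK // => /eqP; rewrite -val_eqE /= !inordK.
have oS : #|[set: 'S_3]| = 6 by rewrite cardsT card_Sn.
apply/idP/andP=> [isoGS | [ncycG /eqP oG]].
  by rewrite (isog_cyclic isoGS) (card_isog isoGS) oS.
apply: isog_trans (noncyclic6_dihedral ncycG oG) _.
by rewrite isog_sym; apply: noncyclic6_dihedral.
Qed.

Lemma isog_Zp_square p G : prime p ->
  (G \isog [set: 'Z_p * 'Z_p]) = ~~ cyclic G && (#|G| == p ^ 2).
Proof.
move=> pr_p; have p_gt1 := prime_gt1 pr_p.
have oZ : #|[set: 'Z_p * 'Z_p]| = p ^ 2.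
  by rewrite cardsT card_prod card_ord Zp_cast.
have abelZ : p.-abelem [set: 'Z_p * 'Z_p].
  apply/abelemP=> //; split.
    by apply/centsP=> -[a b] _ [c d] _; congr pair; apply: Zp_mulgC.
  move=> z _; have -> k : (z ^+ k)%g = (z.1 ^+ k, z.2 ^+ k)%g.
    by elim: k => // k IHk; rewrite !expgS IHk.
  have Zp_p (a : 'Z_p) : (a ^+ p)%g = 1%g.
    by rewrite Zp_expg; apply: val_inj; rewrite /= [X in modn _ X]Zp_cast // modnMl.
  by rewrite !Zp_p.
have ncycZ : ~~ cyclic [set: 'Z_p * 'Z_p].
  by rewrite (abelem_cyclic abelZ) oZ pfactorK.
apply/idP/andP=> [isoGZ | [ncycG /eqP oG]].
  by rewrite (isog_cyclic isoGZ) (card_isog isoGZ) oZ.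
by rewrite (isog_abelem_card _ (noncyclic_p2_abelem pr_p ncycG oG)) abelZ oG oZ eqxx.
Qed.

End IsomorphismTypes.

(** * Comparison with 2 + 4 / n *)

Import Order.TTheory GRing.Theory Num.Theory.
Local Open Scope ring_scope.

Lemma sigma1E (gT : finGroupType) (G : {group gT}) :
  sigma1 G = (\sum_(H in subgroups G) #|H|)%:R / #|G|%:R.
Proof. by rewrite /sigma1 -mulr_suml natr_sum. Qed.

Theorem theorem1 (gT : finGroupType) (G : {group gT}) (n : nat)
    (hn : #|G| = n) :
  (sigma1 G < 2 + 4 / n%:R <->
     (cyclic G /\ (sum_divisors n < 2 * n + 4)%N)
     \/ G \isog [set: 'Z_2 * 'Z_2])
  /\
  (sigma1 G = 2 + 4 / n%:R <->
     (cyclic G /\ sum_divisors n = (2 * n + 4)%N)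
     \/ G \isog [set: 'Z_3 * 'Z_3]
     \/ G \isog [set: 'S_3]).
Proof.
have n0 : (0 : rat) < n%:R by rewrite ltr0n -hn cardG_gt0.
have -> : 2 + 4 / n%:R = (2 * n + 4)%:R / n%:R :> rat.
  by rewrite natrD natrM [RHS]mulrDl mulfK // gt_eqF.
have iZ2 := isog_Zp_square G (isT : prime 2).
have iZ3 := isog_Zp_square G (isT : prime 3).
rewrite sigma1E hn ltr_pM2r ?invr_gt0 // ltr_nat iZ2 iZ3 isog_S3 hn.
set S := (\sum_(H in subgroups G) _)%N.
have -> : S%:R / n%:R = (2 * n + 4)%:R / n%:R :> rat <-> S = (2 * n + 4)%N.
  split=> [/mulIf eqS | -> //]; apply/eqP; rewrite -(eqr_nat rat) eqS //.
  by rewrite invr_eq0 gt_eqF.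
have [cycG | ncycG] := boolP (cyclic G).
  rewrite /S sum_card_cyclic // hn; split; split.
  - by left.
  - by case=> [[]|].
  - by left.
  by case=> [[]|[]].
have sumS := sum_card_noncyclic ncycG; rewrite hn -/S in sumS.
(* sumS reads S = 2 * n + E, so the claims compare E with 4 *)
set E := (\sum_(H : {group gT} | _) _)%N in sumS.
have E4 : n = 4%N -> E = 3%N by move=> n4; apply: (@defect_pq _ G 2 2); rewrite ?hn.
have E9 : n = 9%N -> E = 4%N by move=> n9; apply: (@defect_pq _ G 3 3); rewrite ?hn.
have E6 : n = 6%N -> E = 4%N by move=> n6; apply: (@defect_pq _ G 3 2); rewrite ?hn.
have small : (E <= 4)%N -> [\/ n = 4, n = 6 | n = 9]%N.
  move/(order_small_defect ncycG); rewrite hn !inE.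
  by case/or3P=> /eqP; [constructor 1 | constructor 2 | constructor 3].
rewrite /=; split; split.
- move=> lt_S; right; case: small => [|||]; first by lia.
  + by move=> ->.
  + by move/E6; lia.
  by move/E9; lia.
- by case=> [[] // | /eqP n4]; have := E4 n4; lia.
- move=> eq_S; right; case: small => [|||]; first by lia.
  + by move/E4; lia.
  + by move=> ->; right.
  by move=> ->; left.
by case=> [[] // | [] /eqP n_eq]; [have := E9 n_eq | have := E6 n_eq]; lia.
Qed.
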